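(* Let $s\in\mathbb{R}$ be fixed such that $s^2$ is rational. Then the multiplicities of the eigenvalues of $P_s$ are not uniformly bounded, i.e. for every $M>0$ there exists an eigenvalue $E$ of $P_s$ with $\dim\ker(P_s-E)>M$.
   Context: $X=\mathbb{R}\times\mathbb{S}^1$ is the infinite cylinder with fundamental domain $\mathbb{R}\times[-\pi,\pi]$ (coordinates $(x,y)$) and Lebesgue measure. $L^2_0(X)$ is the closed subspace of (complex-valued) $u\in L^2(X)$ with $\int_{\mathbb{S}^1}u(x,y)\,dy=0$ for a.e. $x$. For $s\in\mathbb{R}$, $P_s=-\partial_x^2-(x^2+s^2)\partial_y^2$ acting in $L^2_0(X)$, meaning the unique self-adjoint extension of this operator defined on the smooth compactly supported functions in $L^2_0(X)$; it has compact resolvent. *)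

(* Defs.v *)
From HB Require Import structures.
From mathcomp Require Import all_boot all_order all_algebra.
From mathcomp Require Import complex.
From mathcomp Require Import all_classical all_reals all_analysis.

Set Implicit Arguments.
Unset Strict Implicit.
Unset Printing Implicit Defensive.

Import Order.TTheory GRing.Theory Num.Theory.
Import numFieldNormedType.Exports.

Local Open Scope classical_set_scope.
Local Open Scope ring_scope.
Local Open Scope complex_scope.

Section Cylinder.
Context {R : realType}.
Local Notation Re := (@complex.Re R).
Local Notation Im := (@complex.Im R).

Definition cintegral d (T : measurableType d) (mu : {measure set T -> \bar R})
    (D : set T) (f : T -> R[i]) : R[i] :=
  (\int[mu]_(x in D) Re (f x)) +i* (\int[mu]_(x in D) Im (f x)).

(* A function on the cylinder is a function of (x, y) in R * R.  Elements of
   L^2 are only looked at on the fundamental domain, up to null sets; the smooth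
   functions (see [test_function]) are defined on the whole plane and
   2pi-periodic in y. *)
Definition cfun : Type := R * R -> R[i].

Definition fund_dom : set (R * R) := [set z | z.2 \in `[- pi, pi]].

Definition leb2 : {measure set (measurableTypeR R * measurableTypeR R) -> \bar R} :=
  (lebesgue_measure \x lebesgue_measure)%E.

Definition ae_equal (u v : cfun) : Prop := ae_eq leb2 fund_dom u v.

Definition in_L2 (u : cfun) : Prop :=
  (Re \o u) \_ fund_dom \in Lfun leb2 2%:E /\
  (Im \o u) \_ fund_dom \in Lfun leb2 2%:E.

Definition in_L20 (u : cfun) : Prop :=
  in_L2 u /\
  {ae lebesgue_measure, forall x : R,
     cintegral lebesgue_measure `[- pi, pi] (fun y => u (x, y)) = 0}.

Definition inner (u v : cfun) : R[i] :=
  cintegral leb2 fund_dom (fun z => u z * (v z)^*).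

Definition L2norm (u : cfun) : R := Num.sqrt (Re (inner u u)).

(* Unbounded operators in L^2_0 are given by their graphs, on representatives:
   the last two clauses say that the graph is a union of classes modulo a.e.
   equality, and that it is single-valued on classes. *)
Definition is_operator (A : set (cfun * cfun)) : Prop :=
  [/\ forall u f, A (u, f) -> in_L20 u /\ in_L20 f,
      A (fun=> 0, fun=> 0),
      forall (c : R[i]) u f v g, A (u, f) -> A (v, g) ->
        A (fun z => c * u z + v z, fun z => c * f z + g z),
      forall u f v g, A (u, f) -> in_L20 v -> in_L20 g ->
        ae_equal u v -> ae_equal f g -> A (v, g)
    & forall u f g, A (u, f) -> A (u, g) -> ae_equal f g].

Definition densely_defined (A : set (cfun * cfun)) : Prop :=
  forall v, in_L20 v -> forall e : R, 0 < e ->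
  exists u f, A (u, f) /\ L2norm (fun z => u z - v z) < e.

Definition adjoint (A : set (cfun * cfun)) : set (cfun * cfun) :=
  [set p | [/\ in_L20 p.1, in_L20 p.2
             & forall u f, A (u, f) -> inner f p.1 = inner u p.2]].

Definition self_adjoint (A : set (cfun * cfun)) : Prop :=
  [/\ is_operator A, densely_defined A & A = adjoint A].

Definition partial (v : R * R) (f : cfun) : cfun := fun z =>
  ('D_v (Re \o f) z) +i* ('D_v (Im \o f) z).

Definition dx : cfun -> cfun := partial (1, 0).
Definition dy : cfun -> cfun := partial (0, 1).

(* C^oo: every iterated directional derivative, in any directions, exists and is
   (Frechet) differentiable on the whole plane. *)
Definition smooth (f : cfun) : Prop :=
  forall (vs : seq (R * R)) (z : R * R),
    differentiable (Re \o foldr partial f vs) z /\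
    differentiable (Im \o foldr partial f vs) z.

Definition test_function (f : cfun) : Prop :=
  [/\ smooth f,
      forall x y, f (x, y + 2 * pi) = f (x, y),
      exists a : R, forall x y, a < `|x| -> f (x, y) = 0
    & in_L20 f].

Definition P_expr (s : R) (f : cfun) : cfun := fun z =>
  - dx (dx f) z - (z.1 ^+ 2 + s ^+ 2)%:C * dy (dy f) z.

(* P_s is the unique A such that [self_adjoint_extension s A]: the operator is
   essentially self-adjoint on the test functions. *)
Definition self_adjoint_extension (s : R) (A : set (cfun * cfun)) : Prop :=
  self_adjoint A /\ forall f, test_function f -> A (f, P_expr s f).

(* The kernel of A - E: u is in the domain of A and A u = E u. *)
Definition ker_minus (A : set (cfun * cfun)) (E : R) : set cfun :=
  [set u | A (u, fun z => E%:C * u z)].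

Definition is_eigenvalue (A : set (cfun * cfun)) (E : R) : Prop :=
  exists2 u, ker_minus A E u & ~ ae_equal u (fun=> 0).

Definition lin_indep (n : nat) (u : 'I_n -> cfun) : Prop :=
  forall c : 'I_n -> R[i],
    ae_equal (fun z => \sum_(i < n) c i * u i z) (fun=> 0) ->
    forall i, c i = 0.

(* dim V > m, the dimension (possibly infinite) being that of V modulo a.e.
   equality. *)
Definition dim_gt (V : set cfun) (m : nat) : Prop :=
  exists2 u : 'I_m.+1 -> cfun, (forall i, V (u i)) & lin_indep u.

End Cylinder.

Arguments cfun : clear implicits.

(* Main.v *)
Require Import Defs.
From HB Require Import structures.
From mathcomp Require Import all_boot all_order all_algebra.
From mathcomp Require Import complex.
From mathcomp Require Import all_classical all_reals all_analysis.
From mathcomp Require Import measurable_realfun.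
From mathcomp Require Import ring lra.

Set Implicit Arguments.
Unset Strict Implicit.
Unset Printing Implicit Defensive.

Import Order.TTheory GRing.Theory Num.Theory.
Import numFieldNormedType.Exports.

Local Open Scope classical_set_scope.
Local Open Scope ring_scope.
Local Open Scope complex_scope.

(** Separation of variables turns [P_s] into harmonic oscillators: on functions
    [e^(iny) a(x)] with [n > 0] it acts as [- a'' + n^2 x^2 a + s^2 n^2 a], so the
    Hermite functions [a(x) = p(x) e^(- n x^2 / 2)], with [p] the [k]-th Hermite
    polynomial for the frequency [n], are eigenfunctions for the eigenvalue
    [(2k + 1) n + s^2 n^2].  Different [n] give independent functions, so a large
    multiplicity arises as soon as one number has many representations of this
    form.  When [s^2 = a / b], the number [E = 2 b 3^L] has one for each small [j]:
    take [n = 2 b 3^j] and [2 k + 1 = 3^(L - j) - 2 a 3^j], which is odd, and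
    positive if [L] is large ([degenerate_levels]).

    The analytic point is that the eigenfunctions are in the domain of a
    self-adjoint extension [P] of the operator on test functions.  They are not
    compactly supported, but a self-adjoint operator has a closed graph, and
    multiplying an eigenfunction [u] by [phi(x / j)], with [phi] a smooth bump and
    [phi(0) = 1], gives test functions [u_j] such that [u_j] tends to [u] and
    [P_s u_j] to [E u].  Both convergences are pointwise and dominated by a
    multiple of [1 / (1 + x^2)], which is square integrable on the cylinder; so the
    inner products with any pair in the graph converge, and the symmetry relation
    passes to the limit ([graph_closed], [eigenmode_in_graph]).

    Independence is checked pointwise: a combination of the eigenfunctions that
    vanishes almost everywhere vanishes everywhere on the open strip by continuity;
    at an abscissa where no Hermite function is zero, it is a polynomial in
    [e^(iy)] with infinitely many roots ([modes_lin_indep]). *)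

(** * Smooth functions of one variable with bounded derivatives *)

Section BoundedSmooth.
Context {R : realType}.
Implicit Types (f g : R -> R) (p : {poly R}) (k : nat) (x t : R).

Definition bounded_fct f := exists C : R, forall x, `|f x| <= C.

(** Boundedness is part of the class because the profiles [a(x)] met below are all
    bounded with all their derivatives, and the bounds are what dominates the
    truncated eigenfunctions.  The recursion on the order makes each closure
    property a short induction. *)
Fixpoint bsmooth_upto k f : Prop :=
  bounded_fct f /\
  if k is k'.+1 then (forall x : R, derivable f x 1) /\ bsmooth_upto k' (derive1 f)
  else True.

Definition bsmooth f := forall k, bsmooth_upto k f.

Lemma derive1_fun f f' : (forall x : R, is_derive x 1 f (f' x)) -> derive1 f = f'.
Proof. by move=> df; apply/funext => x; rewrite derive1E; exact: derive_val. Qed.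

Lemma bsmooth_uptoS k f f' : bounded_fct f ->
  (forall x : R, is_derive x 1 f (f' x)) -> bsmooth_upto k f' ->
  bsmooth_upto k.+1 f.
Proof. by move=> bf df bf'; split=> //; rewrite (derive1_fun df). Qed.

Lemma bsmooth_upto_bounded k f : bsmooth_upto k f -> bounded_fct f.
Proof. by case: k => [|k] []. Qed.

Lemma bsmooth_upto_deriv k f : bsmooth_upto k.+1 f ->
  forall x : R, is_derive x 1 f (derive1 f x).
Proof. by move=> [_ [df _]] x; rewrite derive1E; apply: derivableP. Qed.

Lemma bsmooth_uptoW k f : bsmooth_upto k.+1 f -> bsmooth_upto k f.
Proof.
elim: k f => [|k IH] f; first by move=> [].
by move=> [bf [df bf']]; split=> //; split=> //; apply: IH.
Qed.

Lemma bsmooth_bounded f : bsmooth f -> bounded_fct f.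
Proof. by move=> /(_ 0%N)[]. Qed.

Lemma bsmooth_is_derive f x : bsmooth f -> is_derive x 1 f (derive1 f x).
Proof. by move=> /(_ 1%N) /bsmooth_upto_deriv. Qed.

Lemma bsmooth_derive1 f : bsmooth f -> bsmooth (derive1 f).
Proof. by move=> bf k; have [_ []] := bf k.+1. Qed.

Lemma bsmooth_continuous f : bsmooth f -> continuous f.
Proof.
by move=> bf x; apply/differentiable_continuous/derivable1_diffP;
  have [] := bsmooth_is_derive x bf.
Qed.

Lemma bounded_fctD f g : bounded_fct f -> bounded_fct g -> bounded_fct (f \+ g).
Proof.
move=> [C fC] [D gD]; exists (C + D) => x.
by rewrite (le_trans (ler_normD _ _))// lerD.
Qed.

Lemma bounded_fctM f g : bounded_fct f -> bounded_fct g -> bounded_fct (f \* g).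
Proof.
by move=> [C fC] [D gD]; exists (C * D) => x; rewrite normrM ler_pM.
Qed.

Lemma bsmooth_uptoD k f g :
  bsmooth_upto k f -> bsmooth_upto k g -> bsmooth_upto k (f \+ g).
Proof.
elim: k f g => [|k IH] f g sf sg.
  split=> //.
  exact: bounded_fctD (bsmooth_upto_bounded sf) (bsmooth_upto_bounded sg).
apply: (@bsmooth_uptoS _ _ (derive1 f \+ derive1 g)).
- exact: bounded_fctD (bsmooth_upto_bounded sf) (bsmooth_upto_bounded sg).
- move=> x; have := bsmooth_upto_deriv sf x; have := bsmooth_upto_deriv sg x.
  by move=> ? ?; apply: is_deriveD.
- by apply: IH; [case: sf => _ []|case: sg => _ []].
Qed.

Lemma bsmooth_uptoM k f g :
  bsmooth_upto k f -> bsmooth_upto k g -> bsmooth_upto k (f \* g).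
Proof.
elim: k f g => [|k IH] f g sf sg.
  split=> //.
  exact: bounded_fctM (bsmooth_upto_bounded sf) (bsmooth_upto_bounded sg).
apply: (@bsmooth_uptoS _ _ ((f \* derive1 g) \+ (g \* derive1 f))).
- exact: bounded_fctM (bsmooth_upto_bounded sf) (bsmooth_upto_bounded sg).
- move=> x; have := bsmooth_upto_deriv sf x; have := bsmooth_upto_deriv sg x.
  by move=> ? ?; apply: is_deriveM.
- apply: bsmooth_uptoD; apply: IH; try exact: bsmooth_uptoW.
  + by case: sg => _ [].
  + by case: sf => _ [].
Qed.

Lemma bsmooth_upto_cst k (c : R) : bsmooth_upto k (cst c).
Proof.
elim: k c => [|k IH] c; first by split=> //; exists `|c|.
by apply: (@bsmooth_uptoS _ _ (cst 0)) (IH 0) => //; exists `|c|.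
Qed.

Lemma is_derive_mul f g x (df dg : R) : is_derive x 1 f df -> is_derive x 1 g dg ->
  is_derive x 1 (fun t => f t * g t) (f x * dg + g x * df).
Proof. by move=> ? ?; exact: is_deriveM. Qed.

Lemma is_derive_affine f (f' a b x : R) :
  is_derive (a * x + b) 1 f f' ->
  is_derive x 1 (fun t => f (a * t + b)) (a * f').
Proof.
move=> df.
have da : is_derive x 1 (fun t : R => a * t + b) a.
  have : is_derive x 1 (a \*: (id : R -> R) + cst b) (a *: 1 + 0).
    by apply: is_deriveD.
  by rewrite addr0 [a *: _]mulr1.
have := @is_derive1_comp _ f (fun t => a * t + b) x _ _ df da.
by rewrite mulrC.
Qed.

Lemma bsmooth_upto_affine k f a b :
  bsmooth_upto k f -> bsmooth_upto k (fun t => f (a * t + b)).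
Proof.
elim: k f => [|k IH] f sf.
  by split=> //; have [[C fC] _] := sf; exists C.
apply: (@bsmooth_uptoS _ _ (cst a \* (fun t => derive1 f (a * t + b)))).
- by have [[C fC] _] := sf; exists C.
- move=> x; apply: is_derive_affine; exact: (bsmooth_upto_deriv sf).
- apply: bsmooth_uptoM (bsmooth_upto_cst _ _) _.
  by apply: IH; case: sf => _ [].
Qed.

Lemma bsmooth_cst (c : R) : bsmooth (cst c).
Proof. by move=> k; exact: bsmooth_upto_cst. Qed.

Lemma bsmoothD f g : bsmooth f -> bsmooth g -> bsmooth (f \+ g).
Proof. by move=> bf bg k; exact: bsmooth_uptoD. Qed.

Lemma bsmoothM f g : bsmooth f -> bsmooth g -> bsmooth (f \* g).
Proof. by move=> bf bg k; exact: bsmooth_uptoM. Qed.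

Lemma bsmooth_affine f a b : bsmooth f -> bsmooth (fun t => f (a * t + b)).
Proof. by move=> bf k; exact: bsmooth_upto_affine. Qed.

(** Split [e^(-c|x|)] in two equal factors: one absorbs the leading [x] of
    [p * 'X + a] because [1 + t <= e^t], the other is left for [p]. *)
Lemma horner_expR_bounded p (c : R) : 0 < c ->
  bounded_fct (fun x => p.[x] * expR (- (c * `|x|))).
Proof.
elim/poly_ind: p c => [|p a IH] c c0.
  by exists 0 => x; rewrite horner0 mul0r normr0.
have c20 : 0 < c / 2 by rewrite divr_gt0.
have [C HC] := IH _ c20.
exists (C * (2 / c) + `|a|) => x.
have e1 : `|expR (- (c * `|x|))| <= 1.
  by rewrite ger0_norm ?expR_ge0// expR_le1 oppr_le0 mulr_ge0// ltW.
rewrite hornerMXaddC mulrDl (le_trans (ler_normD _ _))// lerD//; last first.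
  by rewrite normrM ler_piMr.
have -> : expR (- (c * `|x|)) = expR (- (c / 2 * `|x|)) * expR (- (c / 2 * `|x|)).
  by rewrite -expRD; congr expR; field.
rewrite mulrACA normrM ler_pM//.
rewrite normrM (ger0_norm (expR_ge0 _)) expRN ler_pdivrMr ?expR_gt0//.
apply: (@le_trans _ _ (2 / c * (1 + c / 2 * `|x|))).
  have : 0 <= 2 / c by rewrite divr_ge0// ltW.
  have -> : 2 / c * (1 + c / 2 * `|x|) = 2 / c + `|x| by field; rewrite gt_eqF.
  lra.
by rewrite ler_pM2l ?divr_gt0// expR_ge1Dx.
Qed.

(** The factor [w] is the frequency, so that the ground state of
    [- d^2/dx^2 + w^2 x^2] is the case [p = 1]. *)
Definition gauss (w : R) p : R -> R := fun x => p.[x] * expR (- (w / 2 * x ^+ 2)).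

(** By [2|x| <= 1 + x^2] the Gaussian is at most a multiple of [e^(-w|x|)]. *)
Lemma gauss_bounded w p : 0 < w -> bounded_fct (gauss w p).
Proof.
move=> w0; have [C HC] := horner_expR_bounded p w0.
exists (C * expR (w / 2)) => x.
rewrite /gauss normrM.
have H : `|expR (- (w / 2 * x ^+ 2))| <= expR (- (w * `|x|)) * expR (w / 2).
  rewrite ger0_norm ?expR_ge0// -expRD ler_expR.
  have := sqr_ge0 (`|x| - 1); rewrite -[x ^+ 2]real_normK ?num_real//.
  move: `|x| => y; rewrite sqrrB1 => Hy.
  have : 0 <= w / 2 * (y ^+ 2 - y *+ 2 + 1) by rewrite mulr_ge0// divr_ge0// ltW.
  lra.
apply: (le_trans (ler_wpM2l (normr_ge0 _) H)).
rewrite mulrA ler_wpM2r ?expR_ge0//.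
by apply: le_trans (HC x); rewrite normrM (ger0_norm (expR_ge0 _)).
Qed.

(** The family is stable under derivation, hence consists of functions that are
    bounded with all their derivatives. *)
Lemma is_derive_gauss w p x :
  is_derive x 1 (gauss w p) (gauss w (p^`() - w *: ('X * p)) x).
Proof.
have de : is_derive x 1 (fun t => expR (- (w / 2 * t ^+ 2)))
   (expR (- (w / 2 * x ^+ 2)) * (- (w * x))).
  apply: is_derive1_comp.
  have : is_derive x 1 ((- (w / 2)) \*: ((id : R -> R) ^+ 2))
      (- (w / 2) *: ((2%:R * x ^+ 1) *: 1)).
    by apply: is_deriveZ.
  congr (is_derive _ _ _ _).
    by apply/funext => t /=; rewrite /GRing.scale /= mulNr.
  by rewrite /GRing.scale /= expr1; field.
have := is_derive_mul (is_derive_poly p x) de.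
congr (is_derive _ _ _ _).
by rewrite /gauss hornerD hornerN hornerZ hornerM hornerX; ring.
Qed.

Lemma bsmooth_gauss w p : 0 < w -> bsmooth (gauss w p).
Proof.
move=> w0 k; elim: k p => [|k IH] p.
  by split=> //; apply: gauss_bounded.
exact: (bsmooth_uptoS (gauss_bounded _ w0) (@is_derive_gauss w p)).
Qed.

(** The classical flat functions [p(1/t) e^(-1/t)]; allowing a polynomial factor
    makes the family stable under derivation. *)
Definition flat p : R -> R := fun t =>
  if 0 < t then p.[t^-1] * expR (- t^-1) else 0.

Lemma flat_bounded p : bounded_fct (flat p).
Proof.
have [C HC] := horner_expR_bounded p (@ltr01 R).
exists `|C| => t; rewrite /flat; case: ifPn => t0; last by rewrite normr0.
have := HC t^-1; rewrite mul1r (@ger0_norm _ t^-1) ?invr_ge0 ?(ltW t0)// => H.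
exact: (le_trans H (ler_norm _)).
Qed.

(** This is what gives the derivative at [0], by [is_derive0_sqr_bound]. *)
Lemma flat_sqr_bound p : exists C : R, forall t, `|flat p t| <= C * t ^+ 2.
Proof.
have [C HC] := flat_bounded ('X^2 * p).
exists C => t; have := HC t; rewrite /flat; case: ifPn => t0 H.
  rewrite -ler_pdivrMr ?exprn_gt0//; apply: le_trans H.
  rewrite hornerM hornerXn -mulrA (normrM (t^-1 ^+ 2)).
  by rewrite [`|t^-1 ^+ 2|]ger0_norm ?sqr_ge0// exprVn mulrC.
by rewrite normr0 in H *; rewrite mulr_ge0// sqr_ge0.
Qed.

Lemma is_derive0_sqr_bound f (C : R) :
  (forall t, `|f t| <= C * t ^+ 2) -> is_derive (0 : R) 1 f 0.
Proof.
move=> H.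
have f0 : f 0 = 0.
  apply/normr0_eq0/eqP; rewrite eq_le normr_ge0 andbT.
  by have := H 0; rewrite expr0n mulr0.
have cv : (fun h : R => h^-1 *: (f (h *: 1 + 0) - f 0)) @ 0^' --> (0 : R).
  apply/cvgr0Pnorm_lt => e e0.
  have C0 : 0 <= C by have := H 1; rewrite expr1n mulr1; apply: le_trans.
  have d0 : 0 < e / (C + 1) by rewrite divr_gt0// ltr_wpDl.
  near=> h.
  have h0 : h != 0 by near: h; exact: nbhs_dnbhs_neq.
  rewrite addr0 f0 subr0 [h *: 1]mulr1 /GRing.scale /= normrM normfV.
  rewrite mulrC ltr_pdivrMr ?normr_gt0//.
  apply: (le_lt_trans (H h)).
  rewrite -[h ^+ 2]real_normK ?num_real// expr2 mulrA ltr_pM2r ?normr_gt0//.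
  have : `|h| < e / (C + 1).
    near: h; apply: dnbhs0_lt; exact: d0.
  rewrite ltr_pdivlMr ?ltr_wpDl// => He; apply: le_lt_trans He.
  by rewrite mulrDr mulr1 mulrC lerDl.
split; first by apply/cvg_ex; exists 0.
by apply/cvg_lim.
Unshelve. all: by end_near. Qed.

(** Away from [0] this is the chain rule; at [0] the derivative is [0] because the
    function is quadratically small. *)
Lemma is_derive_flat p x : is_derive x 1 (flat p) (flat ('X^2 * (p - p^`())) x).
Proof.
have [x0|x0|->] := ltgtP x 0.
- have -> : flat ('X^2 * (p - p^`())) x = 0 by rewrite /flat ltNge ltW.
  apply: (@near_eq_is_derive _ _ _ (cst 0)) => /=.
  near=> t; rewrite /flat /= ifN// -leNgt ltW//.
  by near: t; exact: lt_nbhsl.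
- have -> : flat ('X^2 * (p - p^`())) x =
      ('X^2 * (p - p^`())).[x^-1] * expR (- x^-1).
    by rewrite /flat x0.
  apply: (@near_eq_is_derive _ _ _ (fun t => p.[t^-1] * expR (- t^-1))).
    near=> t; rewrite /flat ifT//.
    by near: t; exact: lt_nbhsr.
  have xn0 : x != 0 by rewrite gt_eqF.
  have dV : is_derive x 1 (fun t : R => t^-1) (- x ^- 2 *: 1) by apply: is_deriveV.
  have dp : is_derive x 1 (fun t => p.[t^-1]) (p^`().[x^-1] * (- x ^- 2 *: 1)).
    apply: (is_derive1_comp (is_derive_poly p _) dV).
  have dN : is_derive x 1 (fun t : R => - t^-1) (- (- x ^- 2 *: 1)).
    by apply: is_deriveN.
  have de : is_derive x 1 (fun t => expR (- t^-1))
      (expR (- x^-1) * - (- x ^- 2 *: 1)).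
    exact: (is_derive1_comp (is_derive_expR _) dN).
  have := is_derive_mul dp de; congr (is_derive _ _ _ _).
  by rewrite /GRing.scale /= hornerM hornerXn hornerD hornerN exprVn; ring.
- have -> : flat ('X^2 * (p - p^`())) 0 = 0 by rewrite /flat ltxx.
  by have [C HC] := flat_sqr_bound p; exact: is_derive0_sqr_bound HC.
Unshelve. all: by end_near. Qed.

Lemma bsmooth_flat p : bsmooth (flat p).
Proof.
move=> k; elim: k p => [|k IH] p; first by split=> //; apply: flat_bounded.
exact: (bsmooth_uptoS (flat_bounded _) (@is_derive_flat p)).
Qed.

(** The product of a flat function of [1 + t] and one of [1 - t]. It need not be
    constant near [0]: after rescaling, the value at [0] is all that survives. *)
Lemma bump_exists : exists f : R -> R, [/\ bsmooth f, f 0 = 1 &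
  forall t, 1 < `|t| -> f t = 0].
Proof.
pose h t := flat 1 (1 * t + 1) * flat 1 ((-1) * t + 1).
have h0 : h 0 != 0.
  by rewrite /h !mulr0 !add0r /flat ltr01 hornerC mul1r mulf_neq0// expR_eq0.
exists (cst (h 0)^-1 \* h); split.
- apply: bsmoothM (bsmooth_cst _) _.
  by apply: bsmoothM; apply: bsmooth_affine; exact: bsmooth_flat.
- by rewrite /= mulVf.
- move=> t t1 /=; suff -> : h t = 0 by rewrite mulr0.
  rewrite /h /flat mul1r mulN1r; case: ifP => H1; last by rewrite mul0r.
  case: ifP => H2; last by rewrite mulr0.
  by move: t1; rewrite lter_normr => /orP[]; lra.
Qed.

End BoundedSmooth.

(** * Hermite functions *)

Section Hermite.
Context {R : realType}.
Implicit Types (p : {poly R}) (x w : R).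

(** The raising operator [q = 2wXp - p'] sends a solution for [k] to one for
    [k + 1], since then [q' = 2w(k + 1) p]; this formula also shows [q != 0]. *)
Lemma hermite_exists w k : 0 < w -> exists2 p, p != 0 &
  p^`()^`() = (2 * w) *: ('X * p^`()) - (2 * w * k%:R) *: p.
Proof.
move=> w0; elim: k => [|k [p p0 Hp]].
  exists 1; rewrite ?oner_eq0// -[1]/(1%:P) derivC deriv0.
  by rewrite !mulr0 scaler0 scale0r subr0.
pose q := (2 * w) *: ('X * p) - p^`().
have dq : q^`() = (2 * w * k.+1%:R) *: p.
  rewrite /q derivB derivZ derivM derivX mul1r Hp -[k.+1%:R]natr1.
  rewrite mulrDr scalerDr scalerDl mulr1.
  set r := _ *: p; set t := _ *: p; set u := _ *: _; ring.
exists q.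
  apply: contra_eq_neq dq => ->; rewrite raddf0 eq_sym scaler_eq0 negb_or p0 andbT.
  by rewrite !mulf_neq0 ?pnatr_eq0// gt_eqF.
rewrite dq derivZ /q scalerBr [in RHS]scalerA -[in RHS]scalerAr scalerA.
by rewrite [2 * w * _ * _]mulrC opprB addrC subrK.
Qed.

(** The Schroedinger equation of the harmonic oscillator: conjugation by the
    Gaussian turns it into the Hermite equation. *)
Lemma gauss_ode w k p x :
  p^`()^`() = (2 * w) *: ('X * p^`()) - (2 * w * k%:R) *: p ->
  - derive1 (derive1 (gauss w p)) x + (w * x) ^+ 2 * gauss w p x
    = (2 * k + 1)%:R * w * gauss w p x.
Proof.
move=> Hp.
rewrite !(derive1_fun (is_derive_gauss w _)) /gauss.
rewrite !derivB !derivZ !derivM derivX mul1r Hp.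
rewrite !(hornerD, hornerN, hornerZ, hornerM, hornerX).
rewrite natrD natrM; ring.
Qed.

(** Boundedness of [(1 + x^2) p(x) e^(-w x^2 / 2)]. *)
Lemma gauss_decay w p : 0 < w ->
  exists C : R, forall x, `|gauss w p x| <= C * (1 + x ^+ 2)^-1.
Proof.
move=> w0; have [C HC] := gauss_bounded (p * (1%:P + 'X^2)) w0.
exists C => x; have x0 : 0 < 1 + x ^+ 2 by rewrite ltr_wpDr ?sqr_ge0.
rewrite -ler_pdivrMr ?invr_gt0// invrK.
apply: le_trans (HC x).
rewrite /gauss hornerM hornerD hornerXn hornerC.
by rewrite (mulrAC p.[x]) [leRHS]normrM (gtr0_norm x0).
Qed.

End Hermite.

(** * Fourier modes on the cylinder *)

Section Mode.
Context {R : realType}.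
Local Notation Re := (@complex.Re R).
Local Notation Im := (@complex.Im R).
Implicit Types (w s x y c : R) (a b : R -> R) (f : cfun R) (z v : R * R).

(** The function [(a(x) + i b(x)) e^(iwy)].  Its directional derivatives are of the
    same form, with two real profiles even if one starts with [b = 0]; this is the
    reason for the second one. *)
Definition mode w a b : cfun R := fun z =>
  (a z.1 * cos (w * z.2) - b z.1 * sin (w * z.2)) +i*
  (a z.1 * sin (w * z.2) + b z.1 * cos (w * z.2)).

Lemma is_diff_lin (l : R * R -> R) z : linear l -> continuous l -> is_diff z l l.
Proof.
move=> ll cl.
pose lM := GRing.isLinear.Build _ _ _ _ _ ll.
pose L : {linear _ -> _} := HB.pack l lM.
apply: DiffDef; first exact: (@linear_differentiable _ _ _ L).
exact: (@diff_lin _ _ _ L).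
Qed.

Lemma is_diff_fst z : is_diff z (fst : R * R -> R) fst.
Proof. by apply: is_diff_lin => // ?; exact: cvg_fst. Qed.

Lemma is_diff_snd z : is_diff z (snd : R * R -> R) snd.
Proof. by apply: is_diff_lin => // ?; exact: cvg_snd. Qed.

Lemma is_diff1 a x (da : R) : is_derive x 1 a da -> is_diff x a (fun h => h * da).
Proof.
move=> da1; have df : differentiable a x by apply/derivable1_diffP; case: da1.
by apply: DiffDef => //; rewrite diff1E// derive1E derive_val.
Qed.

Lemma is_diff_prod a b z (da db : R) :
  is_derive z.1 1 a da -> is_derive z.2 1 b db ->
  is_diff z (fun z => a z.1 * b z.2)
    (fun v => v.1 * (da * b z.2) + v.2 * (a z.1 * db)).
Proof.
move=> ha hb.
have Ha := is_diff_comp (is_diff_fst z) (is_diff1 ha).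
have Hb := is_diff_comp (is_diff_snd z) (is_diff1 hb).
have := is_diffM Ha Hb.
move=> H; apply: is_diff_eq H _; apply/funext => v.
rewrite !fctE /= /GRing.scale /=; ring.
Qed.

Lemma is_derive_cosM w y :
  is_derive y 1 (fun t => cos (w * t)) (- (w * sin (w * y))).
Proof.
have := @is_derive_affine _ cos (- sin (w * y)) w 0 y.
rewrite mulrN addr0 => /(_ (is_derive_cos _)).
by congr (is_derive _ _ _ _); apply/funext => t; rewrite addr0.
Qed.

Lemma is_derive_sinM w y :
  is_derive y 1 (fun t => sin (w * t)) (w * cos (w * y)).
Proof.
have := @is_derive_affine _ sin (cos (w * y)) w 0 y.
rewrite addr0 => /(_ (is_derive_sin _)).
by congr (is_derive _ _ _ _); apply/funext => t; rewrite addr0.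
Qed.

Lemma mode_is_diff w a b z : bsmooth a -> bsmooth b ->
  is_diff z (Re \o mode w a b) (fun v => Re (mode w
     (fun x => v.1 * derive1 a x - w * v.2 * b x)
     (fun x => v.1 * derive1 b x + w * v.2 * a x) z)) /\
  is_diff z (Im \o mode w a b) (fun v => Im (mode w
     (fun x => v.1 * derive1 a x - w * v.2 * b x)
     (fun x => v.1 * derive1 b x + w * v.2 * a x) z)).
Proof.
move=> sa sb.
have da := bsmooth_is_derive z.1 sa; have db := bsmooth_is_derive z.1 sb.
have dc := is_derive_cosM w z.2; have ds := is_derive_sinM w z.2.
have ac := is_diff_prod da dc; have bs := is_diff_prod db ds.
have as_ := is_diff_prod da ds; have bc := is_diff_prod db dc.
split.
  apply: is_diff_eq (is_diffB ac bs) _; apply/funext => v.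
  rewrite !fctE /=; ring.
apply: is_diff_eq (is_diffD as_ bc) _; apply/funext => v.
rewrite !fctE /=; ring.
Qed.

Lemma partial_mode w a b v : bsmooth a -> bsmooth b ->
  partial v (mode w a b) = mode w
     (fun x => v.1 * derive1 a x - w * v.2 * b x)
     (fun x => v.1 * derive1 b x + w * v.2 * a x).
Proof.
move=> sa sb; apply/funext => z; rewrite /partial.
have [H1 H2] := mode_is_diff w z sa sb.
rewrite !deriveE; [|by case: H2|by case: H1].
rewrite !diff_val.
by case: (mode w _ _ z).
Qed.

Lemma bsmoothZ c a : bsmooth a -> bsmooth (fun x => c * a x).
Proof. exact: bsmoothM (bsmooth_cst c). Qed.

Lemma bsmoothB a b : bsmooth a -> bsmooth b -> bsmooth (fun x => a x - b x).
Proof.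
move=> sa sb.
have -> : (fun x => a x - b x) = (fun x => a x + (-1) * b x).
  by apply/funext => x; rewrite mulN1r.
by apply: bsmoothD => //; exact: bsmoothZ.
Qed.

Lemma bsmooth_partial w a b v : bsmooth a -> bsmooth b ->
  bsmooth (fun x => v.1 * derive1 a x - w * v.2 * b x) /\
  bsmooth (fun x => v.1 * derive1 b x + w * v.2 * a x).
Proof.
move=> sa sb; split; [apply: bsmoothB|apply: bsmoothD];
  by apply: bsmoothZ => //; exact: bsmooth_derive1.
Qed.

Lemma smooth_mode w a b : bsmooth a -> bsmooth b -> smooth (mode w a b).
Proof.
move=> sa sb vs.
have [a' [b' [sa' sb' ->]]] : exists a' b', [/\ bsmooth a', bsmooth b' &
    foldr partial (mode w a b) vs = mode w a' b'].
  elim: vs => [|v vs [a' [b' [sa' sb' IH]]]]; first by exists a, b.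
  have [h1 h2] := bsmooth_partial w v sa' sb'.
  by do 2 eexists; split; [exact: h1|exact: h2|rewrite /= IH partial_mode].
by move=> z; have [H1 H2] := mode_is_diff w z sa' sb'; split; [case: H1|case: H2].
Qed.

Lemma bsmooth0 : bsmooth (fun=> 0 : R). Proof. exact: bsmooth_cst. Qed.

Lemma derive1_0 : derive1 (fun=> 0 : R) = (fun=> 0).
Proof. by apply: derive1_fun => x; exact: is_derive_cst. Qed.

(** On modes [P_s] is a Schroedinger operator acting on the profile. *)
Lemma P_expr_mode s w a : bsmooth a ->
  P_expr s (mode w a (fun=> 0)) =
  mode w (fun x => - derive1 (derive1 a) x + (x ^+ 2 + s ^+ 2) * w ^+ 2 * a x)
    (fun=> 0).
Proof.
move=> sa; have s0 := bsmooth0.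
have E1 : dx (mode w a (fun=> 0)) = mode w (derive1 a) (fun=> 0).
  rewrite /dx partial_mode//; congr (mode w _ _); apply/funext => x /=.
    by rewrite mul1r !mulr0 subr0.
  by rewrite derive1_0 !mulr0 mul0r addr0.
have E2 : dx (dx (mode w a (fun=> 0))) = mode w (derive1 (derive1 a)) (fun=> 0).
  rewrite E1 /dx partial_mode//; last exact: bsmooth_derive1.
  congr (mode w _ _); apply/funext => x /=.
    by rewrite mul1r !mulr0 subr0.
  by rewrite derive1_0 !mulr0 mul0r addr0.
have E3 : dy (mode w a (fun=> 0)) = mode w (fun=> 0) (fun x => w * a x).
  rewrite /dy partial_mode//; congr (mode w _ _); apply/funext => x /=.
    by rewrite mul0r !mulr0 subr0.
  by rewrite mul0r add0r mulr1.
have E4 : dy (dy (mode w a (fun=> 0))) = mode w (fun x => - w ^+ 2 * a x) (fun=> 0).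
  rewrite E3 /dy partial_mode//; last exact: bsmoothZ.
  congr (mode w _ _); apply/funext => x /=.
    by rewrite mul0r mulr1 sub0r mulrA -expr2 mulNr.
  by rewrite mul0r mulr0 addr0.
apply/funext => z; rewrite /P_expr E2 E4 /mode.
apply/eqP; rewrite eq_complex /=; apply/andP; split; apply/eqP; ring.
Qed.

End Mode.

(** * Square integrability and dominated convergence on the strip *)

Section Strip.
Context {R : realType}.
Local Notation Re := (@complex.Re R).
Local Notation Im := (@complex.Im R).
Local Notation leb2 := (@leb2 R).
Local Notation strip := (@fund_dom R).
Local Notation plane := (measurableTypeR R * measurableTypeR R)%type.
Implicit Types (w s x y c : R) (a b : R -> R) (f : cfun R) (z v : R * R).

Lemma Lfun2_sqr_integrable d (T : measurableType d) (mu : {measure set T -> \bar R})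
    (f : T -> R) : measurable_fun setT f ->
  (\int[mu]_x (f x ^+ 2)%:E < +oo)%E -> f \in Lfun mu 2%:E.
Proof.
move=> mf fley; apply/andP; split; first by rewrite inE.
rewrite inE /= /finite_norm unlock; apply: poweR_lty.
apply: le_lt_trans fley; apply: ge0_le_integral => //.
- by move=> x _; exact: poweR_ge0.
- apply/measurable_EFinP.
  have : measurable_fun setT ((fun x : R => x `^ 2) \o (Num.norm \o f)).
    by apply: measurableT_comp => //; exact: measurableT_comp.
  exact.
- by apply/measurable_EFinP; exact: measurable_funX.
- by move=> x _ /=; rewrite lee_fin powR_mulrn// real_normK ?num_real.
Qed.

Lemma integral_oneDsqrV_lty :
  (\int[@lebesgue_measure R]_x (oneDsqr x)^-1%:E < +oo)%E.
Proof.
rewrite (ge0_symfun_integralT (f := fun x => (oneDsqr x)^-1)).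
- by rewrite -set_itvcy integral0y_oneDsqr -EFinM ltry.
- by move=> x; rewrite invr_ge0 addr_ge0// sqr_ge0.
- exact: continuous_oneDsqrV.
- by move=> x /=; rewrite /oneDsqr sqrrN.
Qed.

Lemma measurable_strip : measurable (strip : set plane).
Proof.
have -> : strip = [set: R] `*` `[- pi, pi].
  by apply/seteqP; split=> [z /= ?|z /= []].
by apply: measurableX.
Qed.

(** By Tonelli it is enough that [(1 + x^2)^-2 <= (1 + x^2)^-1] has a finite
    integral over the line. *)
Lemma strip_Lfun2 (f : plane -> R) (C : R) : measurable_fun setT f ->
  (forall z, `|f z| <= C * (1 + z.1 ^+ 2)^-1) ->
  f \_ strip \in Lfun leb2 2%:E.
Proof.
move=> mf fC.
apply: Lfun2_sqr_integrable.
  by apply/(measurable_restrictT _ measurable_strip); exact: measurable_funTS.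
pose g (z : plane) : \bar R :=
  (C ^+ 2 * (oneDsqr z.1)^-1 * \1_(`[- pi, pi]%classic) z.2)%:E.
have mg : measurable_fun setT g.
  apply/measurable_EFinP; apply: measurable_funM.
    apply: measurable_funM => //.
    have : measurable_fun setT ((fun x : R => (oneDsqr x)^-1) \o (fst : plane -> R)).
      apply: measurableT_comp => //; apply: continuous_measurable_fun.
      exact: continuous_oneDsqrV.
    exact.
  have : measurable_fun setT ((\1_(`[- pi, pi]%classic) : R -> R) \o (snd : plane -> R)).
    by apply: measurableT_comp.
  exact.
have o0 x : 0 <= (oneDsqr x)^-1 by rewrite invr_ge0 addr_ge0// sqr_ge0.
have g0 z : (0 <= g z)%E.
  by rewrite lee_fin mulr_ge0// mulr_ge0// sqr_ge0.
apply: (@le_lt_trans _ _ (\int[leb2]_z g z)%E).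
  apply: ge0_le_integral => //.
  - by move=> z _; rewrite lee_fin sqr_ge0.
  - apply/measurable_EFinP; apply: measurable_funX.
    by apply/(measurable_restrictT _ measurable_strip); exact: measurable_funTS.
  - move=> z _; rewrite lee_fin /patch; case: ifPn => zs; last first.
      by rewrite expr0n /= mulr_ge0// mulr_ge0// sqr_ge0.
    rewrite indicE mem_set; last by move: zs; rewrite inE.
    rewrite mulr1 -[_ ^+ 2]real_normK ?num_real//.
    have := fC z; have := o0 z.1; rewrite -/(oneDsqr z.1).
    have : (oneDsqr z.1)^-1 <= 1 by exact: oneDsqrV_le1.
    move: (oneDsqr z.1)^-1 => q q1 q0 H.
    apply: (@le_trans _ _ ((C * q) ^+ 2)).
      by rewrite lerXn2r// nnegrE; exact: le_trans H.
    by rewrite exprMn ler_wpM2l ?sqr_ge0// expr2 ler_piMr.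
rewrite /leb2 fubini_tonelli1// /fubini_F.
under eq_integral => x _.
  rewrite /g /=; under eq_integral => y _ do rewrite EFinM.
  rewrite ge0_integralZl//=;
    [|by apply/measurable_EFinP|by rewrite lee_fin mulr_ge0// sqr_ge0].
  rewrite integral_indic//= setIT lebesgue_measure_itv/= lte_fin.
  rewrite gt0_cp ?pi_gt0// opprK -EFinD -EFinM mulrAC EFinM.
  over.
have p0 : 0 <= C ^+ 2 * (pi + pi) :> R.
  by rewrite mulr_ge0 ?sqr_ge0// addr_ge0 ?pi_ge0.
rewrite ge0_integralZl//=; first by rewrite lte_mul_pinfty// integral_oneDsqrV_lty.
apply/measurable_EFinP; apply: continuous_measurable_fun.
exact: continuous_oneDsqrV.
Qed.

Lemma measurable_fst_comp a : continuous a ->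
  measurable_fun setT (fun z : plane => a z.1).
Proof.
move=> /continuous_measurable_fun ma.
exact: (measurableT_comp ma (@measurable_fst _ _ _ _)).
Qed.

Lemma measurable_snd_comp a : continuous a ->
  measurable_fun setT (fun z : plane => a z.2).
Proof.
move=> /continuous_measurable_fun ma.
exact: (measurableT_comp ma (@measurable_snd _ _ _ _)).
Qed.

Lemma continuous_cosM w : continuous (fun y => cos (w * y)).
Proof.
move=> y; apply: (@continuous_comp _ _ _ ( *%R w) cos).
  exact: mulrl_continuous.
exact: continuous_cos.
Qed.

Lemma continuous_sinM w : continuous (fun y => sin (w * y)).
Proof.
move=> y; apply: (@continuous_comp _ _ _ ( *%R w) sin).
  exact: mulrl_continuous.
exact: continuous_sin.
Qed.

Lemma Re_mode w a : Re \o mode w a (fun=> 0) = fun z => a z.1 * cos (w * z.2).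
Proof. by apply/funext => z /=; rewrite mul0r subr0. Qed.

Lemma Im_mode w a : Im \o mode w a (fun=> 0) = fun z => a z.1 * sin (w * z.2).
Proof. by apply/funext => z /=; rewrite mul0r addr0. Qed.

Definition quad_decay a (C : R) := forall x, `|a x| <= C * (1 + x ^+ 2)^-1.

Lemma mode_in_L2 w a C : continuous a -> quad_decay a C ->
  in_L2 (mode w a (fun=> 0)).
Proof.
move=> ca da; split.
- rewrite Re_mode; apply: (@strip_Lfun2 _ C).
    apply: measurable_funM; first exact: measurable_fst_comp.
    exact: (measurable_snd_comp (@continuous_cosM w)).
  move=> z; apply: le_trans (da z.1); rewrite normrM ler_piMr//.
  by rewrite ler_norml cos_geN1 cos_le1.
- rewrite Im_mode; apply: (@strip_Lfun2 _ C).
    apply: measurable_funM; first exact: measurable_fst_comp.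
    exact: (measurable_snd_comp (@continuous_sinM w)).
  move=> z; apply: le_trans (da z.1); rewrite normrM ler_piMr//.
  by rewrite ler_norml sin_geN1 sin_le1.
Qed.

Lemma sin_natpi n : sin (n%:R * pi) = 0 :> R.
Proof.
elim: n => [|n IH]; first by rewrite mul0r sin0.
by rewrite -natr1 mulrDl mul1r sinDpi IH oppr0.
Qed.

Lemma Rintegral_FTC (g G : R -> R) (a0 b0 : R) : a0 < b0 -> continuous g ->
  (forall y : R, is_derive y 1 G (g y)) ->
  \int[@lebesgue_measure R]_(y in `[a0, b0]) g y = G b0 - G a0.
Proof.
move=> ab cg dG.
have cG : continuous G.
  by move=> y; apply/differentiable_continuous/derivable1_diffP; case: (dG y).
rewrite /Rintegral (@continuous_FTC2 _ g G)//.
- exact: continuous_subspaceT.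
- split; first by move=> y _; case: (dG y).
  + exact/cvg_at_right_filter/cG.
  + exact/cvg_at_left_filter/cG.
- by move=> y _; rewrite (derive1_fun dG).
Qed.

(** The mean over each circle vanishes because [sin] and [cos] of [n y] have
    primitives that take equal values at [- pi] and [pi]. *)
Lemma mode_in_L20 n a C : (0 < n)%N -> continuous a -> quad_decay a C ->
  in_L20 (mode n%:R a (fun=> 0)).
Proof.
move=> n0 ca da; split; first exact: mode_in_L2 da.
have n0' : n%:R != 0 :> R by rewrite pnatr_eq0 -lt0n.
have pipi : - pi < pi :> R by rewrite gt0_cp ?pi_gt0.
apply: aeW => x; rewrite /cintegral.
have ReE : (fun y => Re (mode n%:R a (fun=> 0) (x, y))) =
    (fun y => a x * cos (n%:R * y)).
  by apply/funext => y /=; rewrite mul0r subr0.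
have ImE : (fun y => Im (mode n%:R a (fun=> 0) (x, y))) =
    (fun y => a x * sin (n%:R * y)).
  by apply/funext => y /=; rewrite mul0r addr0.
have dRe y : is_derive y 1 (fun y => a x * n%:R^-1 * sin (n%:R * y))
    (a x * cos (n%:R * y)).
  have := is_derive_mul (is_derive_cst (a x * n%:R^-1) y 1)
    (is_derive_sinM n%:R y).
  by congr (is_derive _ _ _ _); rewrite /= mulr0 addr0 mulrA divfK.
have dIm y : is_derive y 1 (fun y => - (a x * n%:R^-1) * cos (n%:R * y))
    (a x * sin (n%:R * y)).
  have := is_derive_mul (is_derive_cst (- (a x * n%:R^-1)) y 1)
    (is_derive_cosM n%:R y).
  by congr (is_derive _ _ _ _); rewrite /= mulr0 addr0 mulrNN mulrA divfK.
have cRe : continuous (fun y => a x * cos (n%:R * y)).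
  by move=> y; apply: cvgM; [exact: cvg_cst|exact: continuous_cosM].
have cIm : continuous (fun y => a x * sin (n%:R * y)).
  by move=> y; apply: cvgM; [exact: cvg_cst|exact: continuous_sinM].
rewrite ReE ImE (Rintegral_FTC pipi cRe dRe) (Rintegral_FTC pipi cIm dIm).
by rewrite mulrN sinN cosN sin_natpi oppr0 mulr0 !subrr.
Qed.

(** Dominated convergence, with dominating function [(|f1| + |f2|) C / (1 + x^2)],
    integrable as a product of square integrable functions. The real and imaginary
    parts of the inner product of [f1 + i f2] with a mode both have this form. *)
Lemma cvg_strip (f1 f2 c1 c2 : plane -> R) (a_ : nat -> R -> R) a C :
  f1 \_ strip \in Lfun leb2 2%:E -> f2 \_ strip \in Lfun leb2 2%:E ->
  measurable_fun setT c1 -> measurable_fun setT c2 ->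
  (forall z, `|c1 z| <= 1) -> (forall z, `|c2 z| <= 1) ->
  (forall n, continuous (a_ n)) -> continuous a ->
  (forall n, quad_decay (a_ n) C) -> (forall x, a_ ^~ x @ \oo --> a x) ->
  (fun n => \int[leb2]_(z in strip)
     (a_ n z.1 * (f1 z * c1 z + f2 z * c2 z))) @ \oo -->
   \int[leb2]_(z in strip) (a z.1 * (f1 z * c1 z + f2 z * c2 z)).
Proof.
move=> L1 L2 mc1 mc2 c11 c21 ca_ ca da_ cva.
pose G (z : plane) := C * (oneDsqr z.1)^-1.
have mG : measurable_fun setT G.
  apply: measurable_funM => //.
  exact: (measurable_fst_comp (@continuous_oneDsqrV R)).
have G0 z : 0 <= G z by apply: le_trans (da_ 0%N z.1).
have LG : G \_ strip \in Lfun leb2 2%:E.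
  by apply: (@strip_Lfun2 _ C) => // z; rewrite ger0_norm.
have abs (f : plane -> R) : f \_ strip \in Lfun leb2 2%:E ->
    leb2.-integrable strip (EFin \o (f \* G)).
  move=> Lf; rewrite -[strip]setTI.
  apply/(integrable_restrict _ measurable_strip measurableT).
  have := Lfun2_mul_Lfun1 Lf LG.
  move/Lfun1_integrable; congr (integrable _ _ _).
  apply/funext => z /=; rewrite /patch; case: ifP => //= _.
  by rewrite mul0r.
have mf (f : plane -> R) : f \_ strip \in Lfun leb2 2%:E -> measurable_fun strip f.
  move=> /sub_Lfun_mfun; rewrite inE => mf.
  exact/(measurable_restrictT _ measurable_strip).
have ma b : continuous b -> measurable_fun strip (fun z : plane => b z.1).
  by move=> cb; apply: measurable_funTS; exact: measurable_fst_comp.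
pose h b z := b z.1 * (f1 z * c1 z + f2 z * c2 z).
have mh b : continuous b -> measurable_fun strip (EFin \o h b).
  move=> cb; apply/measurable_EFinP; apply: measurable_funM; first exact: ma.
  by apply: measurable_funD; apply: measurable_funM;
    [exact: mf|exact: measurable_funTS|exact: mf|exact: measurable_funTS].
have ig : leb2.-integrable strip (fun z => (`|f1 z * G z| + `|f2 z * G z|)%:E).
  have := integrableD measurable_strip
    (integrable_abse (abs _ L1)) (integrable_abse (abs _ L2)).
  by congr (integrable _ _ _).
have hle n z : (`|(EFin \o h (a_ n)) z| <= (`|f1 z * G z| + `|f2 z * G z|)%:E)%E.
  rewrite lee_fin /h normrM.
  have H1 : `|f1 z * c1 z + f2 z * c2 z| <= `|f1 z| + `|f2 z|.
    rewrite (le_trans (ler_normD _ _))// lerD// normrM ler_piMr//.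
  apply: (le_trans (ler_pM (normr_ge0 _) (normr_ge0 _) (da_ n z.1) H1)).
  by rewrite (normrM (f1 z)) (normrM (f2 z)) (ger0_norm (G0 z)) -mulrDl mulrC.
have aecv : {ae leb2, forall z, strip z ->
    (fun n => (EFin \o h (a_ n)) z) @ \oo --> (EFin \o h a) z}.
  apply: aeW => z _; apply: cvg_EFin; first exact: nearW.
  by apply: cvgM; [exact: cva|exact: cvg_cst].
have aele : {ae leb2, forall z n, strip z ->
    (`|(EFin \o h (a_ n)) z| <= (`|f1 z * G z| + `|f2 z * G z|)%:E)%E}.
  by apply: aeW => z n _; exact: hle.
have [ih _ cvh] := dominated_convergence measurable_strip
  (fun n => mh _ (ca_ n)) (mh _ ca) aecv ig aele.
apply: fine_cvg; rewrite fineK//; exact: (integrable_fin_num measurable_strip ih).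
Qed.


End Strip.

(** * The eigenfunctions are in the domain *)

Section Graph.
Context {R : realType}.
Local Notation Re := (@complex.Re R).
Local Notation Im := (@complex.Im R).
Local Notation leb2 := (@leb2 R).
Local Notation strip := (@fund_dom R).
Local Notation plane := (measurableTypeR R * measurableTypeR R)%type.
Implicit Types (w s x y c E : R) (a b g : R -> R) (f : cfun R) (z v : R * R).

(** Weak convergence of modes whose profiles converge pointwise with a common
    bound by a multiple of [1 / (1 + x^2)]. *)
Lemma inner_mode_cvg f w (a_ : nat -> R -> R) a C : in_L2 f ->
  (forall n, continuous (a_ n)) -> continuous a ->
  (forall n, quad_decay (a_ n) C) -> (forall x, a_ ^~ x @ \oo --> a x) ->
  (fun n => Re (inner f (mode w (a_ n) (fun=> 0)))) @ \oo -->
    Re (inner f (mode w a (fun=> 0))) /\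
  (fun n => Im (inner f (mode w (a_ n) (fun=> 0)))) @ \oo -->
    Im (inner f (mode w a (fun=> 0))).
Proof.
move=> [L1 L2] ca_ ca da cva.
have mc := measurable_snd_comp (@continuous_cosM R w).
have ms := measurable_snd_comp (@continuous_sinM R w).
have msN : measurable_fun setT (fun z : plane => - cos (w * z.2)).
  exact: measurable_funN.
have bc (z : plane) : `|cos (w * z.2)| <= 1 by rewrite ler_norml cos_geN1 cos_le1.
have bs (z : plane) : `|sin (w * z.2)| <= 1 by rewrite ler_norml sin_geN1 sin_le1.
have bcN (z : plane) : `|- cos (w * z.2)| <= 1 by rewrite normrN.
have ReE b : Re (inner f (mode w b (fun=> 0))) =
    \int[leb2]_(z in strip)
      (b z.1 * ((Re \o f) z * cos (w * z.2) + (Im \o f) z * sin (w * z.2))).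
  apply: eq_Rintegral => z _ /=; case: (f z) => p q /=; ring.
have ImE b : Im (inner f (mode w b (fun=> 0))) =
    \int[leb2]_(z in strip)
      (b z.1 * ((Im \o f) z * cos (w * z.2) + (Re \o f) z * - sin (w * z.2))).
  apply: eq_Rintegral => z _ /=; case: (f z) => p q /=; ring.
split.
  rewrite ReE; under eq_fun do rewrite ReE.
  exact: cvg_strip.
rewrite ImE; under eq_fun do rewrite ImE.
apply: cvg_strip => //.
  exact: measurable_funN.
by move=> z; rewrite normrN.
Qed.

(** The graph of a self-adjoint operator is its own adjoint, and an adjoint is
    cut out by equations between inner products, which pass to weak limits. *)
Lemma graph_closed (P : set (cfun R * cfun R)) w (a_ b_ : nat -> R -> R) a b C :
  self_adjoint P ->
  (forall n, P (mode w (a_ n) (fun=> 0), mode w (b_ n) (fun=> 0))) ->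
  (forall n, continuous (a_ n)) -> (forall n, continuous (b_ n)) ->
  continuous a -> continuous b ->
  (forall n, quad_decay (a_ n) C) -> (forall n, quad_decay (b_ n) C) ->
  (forall x, a_ ^~ x @ \oo --> a x) -> (forall x, b_ ^~ x @ \oo --> b x) ->
  in_L20 (mode w a (fun=> 0)) -> in_L20 (mode w b (fun=> 0)) ->
  P (mode w a (fun=> 0), mode w b (fun=> 0)).
Proof.
move=> [[PL20 _ _ _ _] _ PE] Pab ca_ cb_ ca cb da db cva cvb La Lb.
rewrite PE; split=> //= v f Pvf.
have [[Lv _] [Lf _]] := PL20 _ _ Pvf.
have eqn n : inner f (mode w (a_ n) (fun=> 0)) = inner v (mode w (b_ n) (fun=> 0)).
  by move: (Pab n); rewrite PE => -[_ _ /=]; apply.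
have [Ra Ia] := inner_mode_cvg w Lf ca_ ca da cva.
have [Rb Ib] := inner_mode_cvg w Lv cb_ cb db cvb.
apply/eqP; rewrite eq_complex; apply/andP; split; apply/eqP.
  apply: (cvg_unique (@norm_hausdorff _ _) Ra).
  by move: Rb; under eq_fun do rewrite -eqn.
apply: (cvg_unique (@norm_hausdorff _ _) Ia).
by move: Ib; under eq_fun do rewrite -eqn.
Qed.

Lemma cosDn2pi n y : cos (y + n%:R * (2 * pi)) = cos y.
Proof. by rewrite !mulr_natl; exact: periodicn (@cosD2pi R) n y. Qed.

Lemma sinDn2pi n y : sin (y + n%:R * (2 * pi)) = sin y.
Proof. by rewrite !mulr_natl; exact: periodicn (@sinD2pi R) n y. Qed.

Lemma test_mode n a C (A : R) : (0 < n)%N -> bsmooth a -> quad_decay a C ->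
  (forall x, A < `|x| -> a x = 0) -> test_function (mode n%:R a (fun=> 0)).
Proof.
move=> n0 sa da aA; split.
- exact: smooth_mode sa bsmooth0.
- by move=> x y; rewrite /mode /= (mulrDr _ y) cosDn2pi sinDn2pi.
- exists A => x y xA; rewrite /mode /= aA//.
  by apply/eqP; rewrite eq_complex /= !mul0r subr0 addr0 eqxx.
- exact: (mode_in_L20 n0 (bsmooth_continuous sa) da).
Qed.

Lemma quad_decayM a b C B : quad_decay a C -> (forall x, `|b x| <= B) ->
  quad_decay (fun x => b x * a x) (B * C).
Proof.
move=> da bB x; rewrite normrM -mulrA ler_pM//; exact: da.
Qed.

Lemma quad_decayD a b C D : quad_decay a C -> quad_decay b D ->
  quad_decay (fun x => a x + b x) (C + D).
Proof.
by move=> da db x; rewrite (le_trans (ler_normD _ _))// mulrDl lerD.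
Qed.

Lemma quad_decayW a C D : C <= D -> quad_decay a C -> quad_decay a D.
Proof.
move=> CD da x; apply: le_trans (da x) _.
by rewrite ler_wpM2r// invr_ge0 addr_ge0// sqr_ge0.
Qed.

(** Truncation by [phi(x / j)] changes [P_s u] by the two commutator terms
    [- 2 phi'(x / j) g' / j] and [- phi''(x / j) g / j^2], which vanish in the
    limit. *)
Lemma eigenmode_in_graph (P : set (cfun R * cfun R)) s n g C C' E :
  self_adjoint_extension s P -> (0 < n)%N ->
  bsmooth g -> quad_decay g C -> quad_decay (derive1 g) C' ->
  (forall x,
    - derive1 (derive1 g) x + (x ^+ 2 + s ^+ 2) * n%:R ^+ 2 * g x = E * g x) ->
  P (mode n%:R g (fun=> 0), fun z => E%:C * mode n%:R g (fun=> 0) z).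
Proof.
move=> [Psa Pext] n0 sg dg dg' eig.
have [phi [sphi phi0 phiA]] := @bump_exists R.
have sphi1 := bsmooth_derive1 sphi; have sphi2 := bsmooth_derive1 sphi1.
have sg1 := bsmooth_derive1 sg.
have [B0 HB0] := bsmooth_bounded sphi.
have [B1 HB1] := bsmooth_bounded sphi1.
have [B2 HB2] := bsmooth_bounded sphi2.
have cg := bsmooth_continuous sg.
pose e j : R := j.+1%:R^-1.
have e0 j : 0 <= e j by rewrite invr_ge0.
have e1 j : e j <= 1 by rewrite invf_le1// ler1n.
pose a_ j x := phi (e j * x + 0) * g x.
have sa j : bsmooth (a_ j) by apply: bsmoothM => //; exact: bsmooth_affine.
have da1 j : derive1 (a_ j) = fun x =>
    phi (e j * x + 0) * derive1 g x + g x * (e j * derive1 phi (e j * x + 0)).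
  apply: derive1_fun => x; apply: is_derive_mul; last exact: bsmooth_is_derive.
  by apply: is_derive_affine; exact: bsmooth_is_derive.
have da2 j : derive1 (derive1 (a_ j)) = fun x =>
    phi (e j * x + 0) * derive1 (derive1 g) x
    + derive1 g x * (e j * derive1 phi (e j * x + 0))
    + (g x * (e j * (e j * derive1 (derive1 phi) (e j * x + 0)))
       + e j * derive1 phi (e j * x + 0) * derive1 g x).
  rewrite da1; apply: derive1_fun => x; apply: is_deriveD.
    apply: is_derive_mul; last exact: bsmooth_is_derive.
    by apply: is_derive_affine; exact: bsmooth_is_derive.
  apply: is_derive_mul; first exact: bsmooth_is_derive.
  have H : is_derive x 1 (fun t => derive1 phi (e j * t + 0))
      (e j * derive1 (derive1 phi) (e j * x + 0)).
    by apply: is_derive_affine; exact: bsmooth_is_derive.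
  exact: is_deriveZ.
pose b_ j x := phi (e j * x + 0) * (E * g x)
   + ((- 2 * e j * derive1 phi (e j * x + 0)) * derive1 g x
   + (- e j ^+ 2 * derive1 (derive1 phi) (e j * x + 0)) * g x).
(* The eigenvalue equation absorbs the potential, which is unbounded: b_ j has no
   term in x ^+ 2. *)
have Pb j : P_expr s (mode n%:R (a_ j) (fun=> 0)) = mode n%:R (b_ j) (fun=> 0).
  rewrite P_expr_mode//; congr (mode _ _ _); apply/funext => x.
  rewrite da2 /b_ -eig /a_; ring.
have dEg : quad_decay (fun x => E * g x) (`|E| * C) by exact: quad_decayM.
have D0 : 0 <= C by have := dg 0; rewrite expr0n addr0 invr1 mulr1; exact: le_trans.
have D1 : 0 <= C'.
  by have := dg' 0; rewrite expr0n addr0 invr1 mulr1; exact: le_trans.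
have bB0 : 0 <= B0 by apply: le_trans (HB0 0).
have bB1 : 0 <= B1 by apply: le_trans (HB1 0).
have bB2 : 0 <= B2 by apply: le_trans (HB2 0).
have dmb j : quad_decay (b_ j) (B0 * (`|E| * C) + ((2 * B1) * C' + B2 * C)).
  apply: quad_decayD; first exact: quad_decayM.
  apply: quad_decayD; apply: quad_decayM => // x.
    rewrite !normrM normrN (ger0_norm (e0 j)) (ger0_norm (ler0n R 2)).
    rewrite -mulrA ler_wpM2l//.
    by rewrite -[leRHS]mul1r ler_pM.
  rewrite normrM normrN normrX (ger0_norm (e0 j)) -[leRHS]mul1r ler_pM ?exprn_ge0//.
  exact: exprn_ile1.
have dma j : quad_decay (a_ j) (B0 * C) by exact: quad_decayM.
have cve : e @ \oo --> 0 by exact: cvg_harmonic.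
have cvex x : (fun j => e j * x + 0) @ \oo --> 0.
  have : (fun j => e j * x + 0) @ \oo --> 0 * x + 0.
    by apply: cvgD; [apply: cvgM => //; exact: cvg_cst|exact: cvg_cst].
  by rewrite mul0r addr0.
have cvphi (p : R -> R) x : bsmooth p -> (fun j => p (e j * x + 0)) @ \oo --> p 0.
  move=> sp; apply: (cvg_comp _ _ (cvex x)); exact: (bsmooth_continuous sp).
have cva x : a_ ^~ x @ \oo --> g x.
  rewrite -[g x]mul1r -phi0; apply: cvgM; last exact: cvg_cst.
  exact: cvphi.
have cvb x : b_ ^~ x @ \oo --> E * g x.
  have -> : E * g x = phi 0 * (E * g x) + (- 2 * 0 * derive1 phi 0 * derive1 g x
       + - (0 : R) ^+ 2 * derive1 (derive1 phi) 0 * g x).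
    rewrite phi0 expr0n /=; ring.
  apply: cvgD; first by apply: cvgM; [exact: cvphi|exact: cvg_cst].
  apply: cvgD; apply: cvgM; try exact: cvg_cst.
    apply: cvgM; last exact: cvphi.
    by apply: cvgM => //; exact: cvg_cst.
  apply: cvgM; last exact: cvphi.
  by apply: cvgN; rewrite !expr2; exact: cvgM.
have -> : (fun z => E%:C * mode n%:R g (fun=> 0) z) =
    mode n%:R (fun x => E * g x) (fun=> 0).
  apply/funext => z; apply/eqP; rewrite eq_complex /=.
  by apply/andP; split; apply/eqP; ring.
have cEg : continuous (fun x => E * g x).
  by apply: bsmooth_continuous; exact: bsmoothZ.
have cb j : continuous (b_ j).
  apply: bsmooth_continuous; apply: bsmoothD.
    by apply: bsmoothM; [exact: bsmooth_affine|exact: bsmoothZ].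
  by apply: bsmoothD; apply: bsmoothM => //; apply: bsmoothZ; exact: bsmooth_affine.
pose K := B0 * C + (B0 * (`|E| * C) + ((2 * B1) * C' + B2 * C)).
apply: (@graph_closed P n%:R a_ b_ g _ K) => //.
- move=> j; rewrite -Pb; apply: Pext.
  apply: (@test_mode n _ _ j.+1%:R n0 (sa j) (dma j)) => x xj.
  rewrite /a_ addr0 phiA ?mul0r// normrM (ger0_norm (e0 j)) mulrC.
  by rewrite ltr_pdivlMr// mul1r.
- by move=> j; exact: bsmooth_continuous.
- move=> j; apply: quad_decayW (dma j); rewrite lerDl !addr_ge0// !mulr_ge0//.
- move=> j; apply: quad_decayW (dmb j); rewrite lerDr mulr_ge0//.
- exact: (mode_in_L20 n0 cg dg).
- exact: (mode_in_L20 n0 cEg dEg).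
Qed.

End Graph.

(** * Linear independence *)

(** Used over the reals to find a common non-root of nonzero polynomials, and over
    the complex numbers with the roots [e^(iy)]. *)
Lemma poly_eq0_inj_roots (F : idomainType) (p : {poly F}) (r : nat -> F) :
  injective r -> (forall k, root p (r k)) -> p = 0.
Proof.
move=> r_inj pr; apply: contraTeq isT => p0.
have := @max_poly_roots _ p [seq r k | k <- iota 0 (size p)] p0.
rewrite size_map size_iota ltnn map_inj_uniq// iota_uniq => H.
by apply: contraT => _; apply: H => //; apply/allP => _ /mapP[k _ ->].
Qed.

Section Independence.
Context {R : realType}.
Local Notation Re := (@complex.Re R).
Local Notation Im := (@complex.Im R).
Local Notation leb2 := (@leb2 R).
Local Notation strip := (@fund_dom R).
Local Notation plane := (measurableTypeR R * measurableTypeR R)%type.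
Implicit Types (w s x y c E : R) (a b g : R -> R) (f : cfun R) (z v : R * R).

(** Otherwise [h] is nonzero on a product of two intervals inside the strip, whose
    measure is positive. *)
Lemma ae_eq0_continuous (h : R * R -> R) : continuous h ->
  {ae leb2, forall z, strip z -> h z = 0} ->
  forall x y, - pi < y < pi -> h (x, y) = 0.
Proof.
move=> ch [N [mN N0 hN]] x y yI; apply: contraTeq isT => hxy.
have : \forall z \near (x, y), h z != 0 /\ - pi < z.2 < pi.
  have /andP[y1 y2] := yI.
  have H0 : \forall z \near (x, y), h z != 0 by exact: cvgr_neq0 _ (ch (x, y)) hxy.
  have cs : {for (x, y), continuous (snd : R * R -> R)}.
    by apply: differentiable_continuous; case: (is_diff_snd (x, y)).
  have H1 : \forall z \near (x, y), - pi < z.2 by exact: cvgr_gt _ cs _ y1.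
  have H2 : \forall z \near (x, y), z.2 < pi by exact: cvgr_lt _ cs _ y2.
  near=> z; split; first by near: z.
  by apply/andP; split; near: z.
move/nbhs_ballP => [r /= r0 rh].
pose B := (ball x r : set (measurableTypeR R)) `*`
  (ball y r : set (measurableTypeR R)).
have mB : measurable B by apply: measurableX; exact: measurable_ball.
have BN : B `<=` N.
  move=> z [zx zy]; apply: hN => /=; have [hz /andP[z1 z2]] := rh z (conj zx zy).
  move=> /(_ _) H; move/negP: hz; apply; apply/eqP/H.
  by rewrite /fund_dom /= in_itv /= !ltW.
have : (leb2 B <= leb2 N)%E by apply: le_measure => //; rewrite inE.
have -> : leb2 B =
    (@lebesgue_measure R (ball x r) * @lebesgue_measure R (ball y r))%E.
  by apply: product_measure1E; exact: measurable_ball.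
rewrite N0 !lebesgue_measure_ball; [|exact: ltW..].
rewrite -EFinM lee_fin leNgt.
by rewrite mulr_gt0// mulrn_wgt0.
Unshelve. all: by end_near. Qed.

Definition ccontinuous f := continuous (Re \o f) /\ continuous (Im \o f).

Lemma ccontinuous_mode w a : bsmooth a -> ccontinuous (mode w a (fun=> 0)).
Proof.
move=> sa; split=> z; apply: differentiable_continuous;
  have [H1 H2] := mode_is_diff w z sa bsmooth0; [by case: H1|by case: H2].
Qed.

Lemma ccontinuous_sum (I : Type) (r : seq I) (c : I -> R[i]) (u : I -> cfun R) :
  (forall i, ccontinuous (u i)) ->
  ccontinuous (fun z => \sum_(i <- r) c i * u i z).
Proof.
move=> cu; elim: r => [|i r [IH1 IH2]].
  have -> : (fun z => \sum_(i <- [::]) c i * u i z) = cst 0.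
    by apply/funext => z; rewrite big_nil.
  by split; exact: cst_continuous.
have [c1 c2] := cu i; split.
  have -> : Re \o (fun z => \sum_(i <- i :: r) c i * u i z) =
    fun z => (Re (c i) * (Re \o u i) z - Im (c i) * (Im \o u i) z)
       + (Re \o (fun z => \sum_(i <- r) c i * u i z)) z.
    apply/funext => z /=; rewrite big_cons.
    by case: (c i) => p q; case: (u i z) => p' q'; case: (\sum_(_ <- _) _).
  move=> z; apply: cvgD; last exact: IH1.
  by apply: cvgB; apply: cvgM; (try exact: cvg_cst); [exact: c1|exact: c2].
have -> : Im \o (fun z => \sum_(i <- i :: r) c i * u i z) =
  fun z => (Re (c i) * (Im \o u i) z + Im (c i) * (Re \o u i) z)
     + (Im \o (fun z => \sum_(i <- r) c i * u i z)) z.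
  apply/funext => z /=; rewrite big_cons.
  by case: (c i) => p q; case: (u i z) => p' q'; case: (\sum_(_ <- _) _).
move=> z; apply: cvgD; last exact: IH2.
by apply: cvgD; apply: cvgM; (try exact: cvg_cst); [exact: c2|exact: c1].
Qed.

Definition cis y : R[i] := cos y +i* sin y.

Lemma cisX n y : cis y ^+ n = cis (n%:R * y).
Proof.
elim: n => [|n IH]; first by rewrite expr0 mul0r /cis cos0 sin0.
rewrite exprS IH -natr1 mulrDl mul1r addrC /cis cosD sinD.
by apply/eqP; rewrite eq_complex /=; apply/andP; split; apply/eqP; ring.
Qed.

Lemma mode_cis n a x y : mode n%:R a (fun=> 0) (x, y) = (a x)%:C * cis y ^+ n.
Proof.
rewrite cisX; apply/eqP; rewrite eq_complex /=.
by apply/andP; split; apply/eqP; ring.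
Qed.

(** At an abscissa [x] where no [p i] vanishes, the combination is the value at
    [e^(iy)] of the polynomial with coefficients [c i * gauss (w i) (p i) x] at the
    distinct exponents [n i], and this is [0] for infinitely many [e^(iy)]. *)
Lemma modes_lin_indep m (n : 'I_m -> nat) (w : 'I_m -> R) (p : 'I_m -> {poly R}) :
  injective n -> (forall i, 0 < w i) -> (forall i, p i != 0) ->
  lin_indep (fun i => mode (n i)%:R (gauss (w i) (p i)) (fun=> 0)).
Proof.
move=> n_inj w0 p0 c ae0.
pose F z := \sum_(i < m) c i * mode (n i)%:R (gauss (w i) (p i)) (fun=> 0) z.
have [cR cI] : ccontinuous F.
  by apply: ccontinuous_sum => i; apply: ccontinuous_mode; exact: bsmooth_gauss.
have F0 x y : - pi < y < pi -> F (x, y) = 0.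
  move=> yI; apply/eqP; rewrite eq_complex; apply/andP; split; apply/eqP.
    apply: (ae_eq0_continuous cR) => //.
    by apply: filterS ae0 => z H zs; rewrite /= /F H.
  apply: (ae_eq0_continuous cI) => //.
  by apply: filterS ae0 => z H zs; rewrite /= /F H.
have [x px] : exists x, forall i, (p i).[x] != 0.
  apply: contrapT => nx.
  have : \prod_(i < m) p i != 0 by apply/prodf_neq0 => i _.
  move/eqP; apply; apply: (@poly_eq0_inj_roots _ _ (fun k => k%:R)).
    by move=> k l /eqP; rewrite eqr_nat => /eqP.
  move=> k; rewrite rootE horner_prod; apply/eqP/eqP/prodf_eq0.
  apply: contrapT => nk; apply: nx; exists k%:R => i.
  by apply: contra_notN nk => H; exists i.
pose d i := c i * (gauss (w i) (p i) x)%:C.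
pose Q : {poly R[i]} := \sum_(i < m) d i *: 'X^(n i).
have Q0 : Q = 0.
  (* The points 1 / (k + 1) lie in ]0, pi[, where cos is injective. *)
  have y01 k : 0 < (k.+1%:R^-1 : R) < pi.
    rewrite invr_gt0 ltr0n /= (@le_lt_trans _ _ 1) ?invf_le1 ?ler1n//.
    by rewrite (lt_le_trans _ (pi_ge2 R))// ltr1n.
  apply: (@poly_eq0_inj_roots _ _ (fun k => cis (k.+1%:R^-1))).
    move=> k l [H _]; have : (k.+1%:R^-1 : R) = l.+1%:R^-1.
      have yI j : (j.+1%:R^-1 : R) \in `[0, pi].
        by have /andP[? ?] := y01 j; rewrite in_itv /= !ltW.
      exact: (cos_inj (yI k) (yI l) H).
    by move/invr_inj/eqP; rewrite eqr_nat => /eqP[].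
  move=> k; rewrite rootE /Q horner_sum.
  have /andP[yk1 yk2] := y01 k.
  have FE : F (x, k.+1%:R^-1) = 0.
    by apply: F0; rewrite yk2 andbT (lt_trans _ yk1)// oppr_lt0 pi_gt0.
  apply/eqP; rewrite -[RHS]FE; apply: eq_bigr => i _.
  by rewrite hornerZ hornerXn mode_cis /d mulrA.
move=> i; have : Q`_(n i) = 0 by rewrite Q0 coef0.
rewrite /Q coef_sum (bigD1 i)//= coefZ coefXn eqxx mulr1 big1 ?addr0; last first.
  by move=> j ji; rewrite coefZ coefXn (inj_eq n_inj) eq_sym (negbTE ji) mulr0.
move/eqP; rewrite mulf_eq0 => /orP[/eqP //|].
rewrite eq_complex /= eqxx andbT /gauss mulf_eq0 expR_eq0 orbF.
by rewrite (negbTE (px i)).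
Qed.

(** With [s^2 = a / b], [n = 2 b 3^j] and [2 k + 1 = 3^(L - j) - 2 a 3^j] the terms
    [4 a b 3^(2j)] cancel and [(2 k + 1) n + s^2 n^2 = 2 b 3^L], whatever [j]. *)
Lemma degenerate_levels s : (exists q : rat, s ^+ 2 = ratr q) -> forall M : nat,
  exists (E : R) (n k : 'I_M.+1 -> nat), [/\ injective n, forall j, (0 < n j)%N &
    forall j, (2 * k j + 1)%:R * (n j)%:R + s ^+ 2 * (n j)%:R ^+ 2 = E].
Proof.
move=> [q sq] M.
have q0 : 0 <= q by rewrite -(ler0q R) -sq sqr_ge0.
pose a := `|numq q|%N; pose b := `|denq q|%N.
have b0 : (0 < b)%N by rewrite absz_gt0 denq_neq0.
have sab : s ^+ 2 = a%:R / b%:R.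
  rewrite sq /ratr; congr (_ / _).
    by rewrite /a -[in LHS](gez0_abs (_ : 0 <= numq q)) ?numq_ge0.
  by rewrite /b -[in LHS](gez0_abs (denq_ge0 q)).
(* So that 3 ^ (L - j) exceeds 2 a 3 ^ j for all j <= M. *)
pose L := (M + (M + (2 * a).+1))%N.
have big (j : 'I_M.+1) : (2 * a * 3 ^ j <= 3 ^ (L - j))%N.
  have jM : (j <= M)%N by rewrite -ltnS.
  have -> : (L - j = (M - j) + (M + (2 * a).+1))%N by rewrite /L addnBAC.
  apply: (@leq_trans (3 ^ (M + (2 * a).+1))); last by rewrite leq_exp2l// leq_addl.
  rewrite expnD mulnC leq_mul// ?leq_exp2l//.
  by rewrite ltnW// ltnW// ltn_expl.
pose t (j : 'I_M.+1) := (3 ^ (L - j) - 2 * a * 3 ^ j)%N.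
have todd j : odd (t j).
  by rewrite /t oddB// -mulnA oddM /= addbF oddX orbT.
exists (2 * b * 3 ^ L)%:R, (fun j => 2 * b * 3 ^ j)%N, (fun j => (t j)./2); split.
- move=> i j /eqP; rewrite eqn_pmul2l ?muln_gt0// eqn_exp2l// => /eqP.
  exact: val_inj.
- by move=> j; rewrite !muln_gt0 b0 expn_gt0.
move=> j.
have -> : (2 * (t j)./2 + 1 = t j)%N.
  by rewrite mul2n -[RHS]odd_double_half todd addnC.
have jL : (j <= L)%N by rewrite (@leq_trans M) ?leq_addr// -ltnS.
have -> : (3 ^ L = 3 ^ (L - j) * 3 ^ j)%N by rewrite -expnD subnK.
rewrite /t natrB// sab !natrM.
have : b%:R != 0 :> R by rewrite pnatr_eq0 -lt0n.
by move: (3 ^ (L - j))%N (3 ^ j)%N => X Y bn0; field.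
Qed.

End Independence.

Theorem corollary8 (R : realType) (s : R)
  (hs : exists q : rat, s ^+ 2 = ratr q)
  (P : set (cfun R * cfun R)) (hP : self_adjoint_extension s P) :
  forall M : nat, (0 < M)%N ->
  exists E : R, is_eigenvalue P E /\ dim_gt (ker_minus P E) M.
Proof.
move=> M _.
have [E [n [k [n_inj n0 levels]]]] := degenerate_levels hs M.
have w0 i : 0 < (n i)%:R :> R by rewrite ltr0n.
have hermite i : exists p : {poly R}, p != 0 /\
    p^`()^`() = (2 * (n i)%:R) *: ('X * p^`()) - (2 * (n i)%:R * (k i)%:R) *: p.
  by have [p p0 pode] := hermite_exists (k i) (w0 i); exists p.
have [p Hp] := boolp.choice hermite.
have p0 i : p i != 0 by case: (Hp i).
pose u i := mode (n i)%:R (gauss (n i)%:R (p i)) (fun=> 0).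
have ind : lin_indep u by exact: modes_lin_indep.
have ker i : ker_minus P E (u i).
  have [C dC] := gauss_decay (p i) (w0 i).
  have [C' dC'] := gauss_decay ((p i)^`() - (n i)%:R *: ('X * p i)) (w0 i).
  apply: (@eigenmode_in_graph _ P s (n i) _ C C' E hP (n0 i)) => //.
  - exact: bsmooth_gauss.
  - by rewrite (derive1_fun (is_derive_gauss _ _)).
  - move=> x; rewrite -(levels i) !mulrDl.
    have := gauss_ode x (proj2 (Hp i)); rewrite exprMn => <-; ring.
exists E; split; last by exists u.
exists (u ord0) => // u0.
have : ((ord0 == ord0 :> 'I_M.+1)%:R : complex R) = 0.
  apply: (ind (fun i => (i == ord0)%:R)).
  rewrite (_ : (fun z => _) = u ord0)//; apply/funext => z.
  by rewrite (bigD1 ord0)//= mul1r big1 ?addr0// => i /negbTE->; rewrite mul0r.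
by move/eqP; rewrite eqxx oner_eq0.
Qed.
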